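(* Let $\mathcal{A}$ be an abelian category, $N\in\{1,2,3,\dots\}$, and let $\mathcal{B}$ be a full subcategory of $\operatorname{Seq}(\mathcal{A})$ containing $\mathrm{Com}_N(\mathcal{A})$. Then, given any category $\mathcal{C}$ and any functor $\mathrm{E}:\mathrm{Com}_N(\mathcal{A})\to\mathcal{C}$, there is an equivalence of categories $$\mathbf{D}_{\mathrm{H}}(\mathcal{B})\simeq \mathbf{D}_{\mathrm{H}}(\mathrm{Com}_N(\mathcal{A})),$$ where $\mathrm{H}=\mathrm{E}\circ[\ker d^N]:\mathcal{B}\to\mathcal{C}$ (and, on the right-hand side, $\mathrm{H}$ denotes its restriction to $\mathrm{Com}_N(\mathcal{A})$).
   Context: $\operatorname{Seq}(\mathcal{A})$ is the category whose objects (sequences) are families $C=(C_i)_{i\in\mathbb{Z}}$ of objects of $\mathcal{A}$ with arbitrary morphisms $d_i:C_i\to C_{i+1}$ (the differential $d$; no condition imposed), and whose morphisms are families $f_i:C_i\to D_i$ commuting with the differentials. $\mathrm{Com}_N(\mathcal{A})$ (the $N$-complexes) is the full subcategory of sequences with $d^N=0$, i.e. $d_{i+N-1}\cdots d_{i+1}d_i=0$ for all $i\in\mathbb{Z}$. $\mathrm{T}$ denotes the translation functor, $(\mathrm{T}^jC)_i=C_{i+j}$. The differential of $C$ gives a morphism of sequences $\underline{d}_C:C\to \mathrm{T}^1C$, and $\underline{d}_C^N:C\to \mathrm{T}^NC$ denotes its $N$-fold iterate. The functor $[\ker d^N]:\mathcal{B}\to\mathrm{Com}_N(\mathcal{A})$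 sends $C$ to the subsequence $\ker \underline{d}^N_C$ of $C$ (in degree $i$: the kernel of $d^N:C_i\to C_{i+N}$), which is an $N$-complex, and sends $f$ to its restriction to these kernels. It is the identity on $\mathrm{Com}_N(\mathcal{A})$. For a functor $\mathrm{H}:\mathcal{X}\to\mathcal{Y}$, the derived category $\mathbf{D}_{\mathrm{H}}(\mathcal{X})$ is the localization $\mathcal{X}[S]$ of $\mathcal{X}$ at the class $S$ of all morphisms $f$ of $\mathcal{X}$ such that $\mathrm{H}(f)$ is an isomorphism ($\mathrm{H}$-quasi-isomorphisms). The localization $\mathcal{X}\to\mathcal{X}[S]$ is the universal functor sending all morphisms of $S$ to isomorphisms; it can be constructed by adding formal inverses to the morphisms in $S$ (size issues are ignored, i.e. one works in the metacategory of all categories). *)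

(* Defs.v *)
From Stdlib Require Import ZArith Lia.
From Stdlib Require Import FunctionalExtensionality PropExtensionality.
From Stdlib Require Import ProofIrrelevance ClassicalEpsilon.

Set Implicit Arguments.
Unset Strict Implicit.

(** * Categories, functors, equivalences *)

(* Morphisms are compared by Leibniz equality.  There is no local smallness
   assumption: [Ob] and [Hom] live in one fixed universe, in which the
   localization of a category at any class of morphisms exists again. *)
Record Category := {
  Ob :> Type;
  Hom : Ob -> Ob -> Type;
  idm : forall X, Hom X X;
  comp : forall X Y Z, Hom Y Z -> Hom X Y -> Hom X Z;
  comp_id_l : forall X Y (f : Hom X Y), comp (idm Y) f = f;
  comp_id_r : forall X Y (f : Hom X Y), comp f (idm X) = f;
  comp_assoc : forall W X Y Z (h : Hom Y Z) (g : Hom X Y) (f : Hom W X),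
    comp h (comp g f) = comp (comp h g) f }.

Arguments Hom {_} _ _.
Arguments idm {_} _.
Arguments comp {_ _ _ _} _ _.

Notation "g ∘ f" := (comp g f) (at level 40, left associativity).

Definition is_iso (C : Category) (X Y : C) (f : Hom X Y) : Prop :=
  exists g : Hom Y X, g ∘ f = idm X /\ f ∘ g = idm Y.

Definition is_mono (C : Category) (X Y : C) (f : Hom X Y) : Prop :=
  forall (W : C) (g h : Hom W X), f ∘ g = f ∘ h -> g = h.

Definition is_epi (C : Category) (X Y : C) (f : Hom X Y) : Prop :=
  forall (W : C) (g h : Hom Y W), g ∘ f = h ∘ f -> g = h.

Record Functor (C D : Category) := {
  fob :> C -> D;
  fmap : forall X Y : C, Hom X Y -> Hom (fob X) (fob Y);
  fmap_id : forall X : C, fmap (idm X) = idm (fob X);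
  fmap_comp : forall (X Y Z : C) (g : Hom Y Z) (f : Hom X Y),
    fmap (g ∘ f) = fmap g ∘ fmap f }.

Definition functor_id (C : Category) : Functor C C.
Proof.
  refine {| fob := fun X : C => X; fmap := fun _ _ f => f |}; reflexivity.
Defined.

Definition functor_comp (C D E : Category) (G : Functor D E) (F : Functor C D) :
  Functor C E.
Proof.
  refine {| fob := fun X : C => G (F X); fmap := fun _ _ f => fmap G (fmap F f) |};
    intros; now rewrite ?fmap_id, ?fmap_comp.
Defined.

Notation "G ⊚ F" := (functor_comp G F) (at level 40, left associativity).

Definition naturally_isomorphic (C D : Category) (F G : Functor C D) : Prop :=
  exists eta : forall X : C, Hom (F X) (G X),
    (forall (X Y : C) (f : Hom X Y), eta Y ∘ fmap F f = fmap G f ∘ eta X) /\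
    (forall X : C, is_iso (eta X)).

Definition equivalent_categories (C D : Category) : Prop :=
  exists (F : Functor C D) (G : Functor D C),
    naturally_isomorphic (G ⊚ F) (functor_id C) /\
    naturally_isomorphic (F ⊚ G) (functor_id D).

Definition full_subcategory (C : Category) (P : C -> Prop) : Category.
Proof.
  refine {| Ob := {X : C | P X};
            Hom := fun X Y => Hom (proj1_sig X) (proj1_sig Y);
            idm := fun X => idm (proj1_sig X);
            comp := fun _ _ _ g f => g ∘ f |}; intros.
  - apply comp_id_l.
  - apply comp_id_r.
  - apply comp_assoc.
Defined.

Definition subcategory_inclusion (C : Category) (P : C -> Prop) :
  Functor (full_subcategory P) C.
Proof.
  refine (@Build_Functor (full_subcategory P) C
            (fun X => proj1_sig X) (fun _ _ f => f) _ _); reflexivity.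
Defined.

Definition subcategory_widen (C : Category) (P Q : C -> Prop)
  (PQ : forall X, P X -> Q X) :
  Functor (full_subcategory P) (full_subcategory Q).
Proof.
  refine (@Build_Functor (full_subcategory P) (full_subcategory Q)
            (fun X => exist _ (proj1_sig X) (PQ _ (proj2_sig X)))
            (fun _ _ f => f) _ _); reflexivity.
Defined.

(** * Localization and derived categories *)

Definition morphism_class (C : Category) :=
  forall X Y : C, Hom X Y -> Prop.

Definition inverts (C D : Category) (S : morphism_class C) (F : Functor C D) :=
  forall (X Y : C) (s : Hom X Y), S X Y s -> is_iso (fmap F s).

Inductive formal (C : Category) (S : morphism_class C) : C -> C -> Type :=
| formal_mor (X Y : C) (f : Hom X Y) : formal S X Y
| formal_inv (X Y : C) (s : Hom X Y) (Ss : S X Y s) : formal S Y X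
| formal_comp (X Y Z : C) (g : formal S Y Z) (f : formal S X Y) : formal S X Z.

Arguments formal_mor {C} S {X Y} f.
Arguments formal_inv {C S X Y s} Ss.
Arguments formal_comp {C S X Y Z} g f.

Inductive formal_eq (C : Category) (S : morphism_class C) :
  forall X Y : C, formal S X Y -> formal S X Y -> Prop :=
| feq_refl (X Y : C) (f : formal S X Y) : formal_eq f f
| feq_sym (X Y : C) (f g : formal S X Y) : formal_eq f g -> formal_eq g f
| feq_trans (X Y : C) (f g h : formal S X Y) :
    formal_eq f g -> formal_eq g h -> formal_eq f h
| feq_comp (X Y Z : C) (g g' : formal S Y Z) (f f' : formal S X Y) :
    formal_eq g g' -> formal_eq f f' ->
    formal_eq (formal_comp g f) (formal_comp g' f')
| feq_id_l (X Y : C) (f : formal S X Y) :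
    formal_eq (formal_comp (formal_mor S (idm Y)) f) f
| feq_id_r (X Y : C) (f : formal S X Y) :
    formal_eq (formal_comp f (formal_mor S (idm X))) f
| feq_assoc (W X Y Z : C)
    (h : formal S Y Z) (g : formal S X Y) (f : formal S W X) :
    formal_eq (formal_comp h (formal_comp g f)) (formal_comp (formal_comp h g) f)
| feq_mor_comp (X Y Z : C) (g : Hom Y Z) (f : Hom X Y) :
    formal_eq (formal_mor S (g ∘ f))
      (formal_comp (formal_mor S g) (formal_mor S f))
| feq_inv_l (X Y : C) (s : Hom X Y) (Ss : S X Y s) :
    formal_eq (formal_comp (formal_inv Ss) (formal_mor S s)) (formal_mor S (idm X))
| feq_inv_r (X Y : C) (s : Hom X Y) (Ss : S X Y s) :
    formal_eq (formal_comp (formal_mor S s) (formal_inv Ss)) (formal_mor S (idm Y)).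

(* The quotient of [formal S X Y] by [formal_eq], as the type of its
   equivalence classes. *)
Definition loc_hom (C : Category) (S : morphism_class C) (X Y : C) : Type :=
  {P : formal S X Y -> Prop | exists f, P = formal_eq f}.

Definition loc_class (C : Category) (S : morphism_class C) (X Y : C)
  (f : formal S X Y) : loc_hom S X Y :=
  exist _ (formal_eq f) (ex_intro _ f eq_refl).

Definition loc_repr (C : Category) (S : morphism_class C) (X Y : C)
  (p : loc_hom S X Y) : formal S X Y :=
  proj1_sig (constructive_indefinite_description _ (proj2_sig p)).

Lemma loc_class_eq (C : Category) (S : morphism_class C) (X Y : C)
  (f g : formal S X Y) : formal_eq f g -> loc_class f = loc_class g.
Proof.
  intros E. apply subset_eq_compat.
  apply functional_extensionality; intros h; apply propositional_extensionality.
  split; intros E'.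
  - exact (feq_trans (feq_sym E) E').
  - exact (feq_trans E E').
Qed.

Lemma loc_class_inj (C : Category) (S : morphism_class C) (X Y : C)
  (f g : formal S X Y) : loc_class f = loc_class g -> formal_eq f g.
Proof.
  intros E. assert (E' : formal_eq f g = formal_eq g g).
  { exact (f_equal (fun p : loc_hom S X Y => proj1_sig p g) E). }
  rewrite E'. apply feq_refl.
Qed.

Lemma loc_reprK (C : Category) (S : morphism_class C) (X Y : C)
  (p : loc_hom S X Y) : loc_class (loc_repr p) = p.
Proof.
  unfold loc_repr.
  destruct (constructive_indefinite_description _ (proj2_sig p)) as [f Ef].
  destruct p as [P HP]; simpl in *. apply subset_eq_compat. now symmetry.
Qed.

Lemma loc_classK (C : Category) (S : morphism_class C) (X Y : C)
  (f : formal S X Y) : formal_eq (loc_repr (loc_class f)) f.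
Proof. apply loc_class_inj, loc_reprK. Qed.

Definition localization (C : Category) (S : morphism_class C) : Category.
Proof.
  refine {| Ob := C; Hom := loc_hom S;
            idm := fun X => loc_class (formal_mor S (idm X));
            comp := fun _ _ _ g f =>
              loc_class (formal_comp (loc_repr g) (loc_repr f)) |}.
  - intros X Y f. rewrite <- (loc_reprK f) at 2. apply loc_class_eq.
    eapply feq_trans; [|apply feq_id_l].
    apply feq_comp; [apply loc_classK|apply feq_refl].
  - intros X Y f. rewrite <- (loc_reprK f) at 2. apply loc_class_eq.
    eapply feq_trans; [|apply feq_id_r].
    apply feq_comp; [apply feq_refl|apply loc_classK].
  - intros W X Y Z h g f. apply loc_class_eq.
    eapply feq_trans; [apply feq_comp; [apply feq_refl|apply loc_classK]|].
    eapply feq_trans; [apply feq_assoc|].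
    apply feq_comp; [apply feq_sym, loc_classK|apply feq_refl].
Defined.

Definition localization_functor (C : Category) (S : morphism_class C) :
  Functor C (localization S).
Proof.
  refine (@Build_Functor C (localization S) (fun X => X)
            (fun _ _ f => loc_class (formal_mor S f)) _ _).
  - reflexivity.
  - intros X Y Z g f. apply loc_class_eq.
    eapply feq_trans; [apply feq_mor_comp|].
    apply feq_comp; apply feq_sym, loc_classK.
Defined.

Lemma localization_comp_class (C : Category) (S : morphism_class C) (X Y Z : C)
  (g : formal S Y Z) (f : formal S X Y) :
  loc_class (formal_comp g f)
  = @comp (localization S) X Y Z (loc_class g) (loc_class f).
Proof.
  apply loc_class_eq, feq_comp; apply feq_sym, loc_classK.
Qed.

Lemma localization_functor_inverts (C : Category) (S : morphism_class C) :
  inverts S (localization_functor S).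
Proof.
  intros X Y s Ss. exists (loc_class (formal_inv Ss)). split.
  - eapply eq_trans; [symmetry; apply localization_comp_class|].
    apply loc_class_eq, feq_inv_l.
  - eapply eq_trans; [symmetry; apply localization_comp_class|].
    apply loc_class_eq, feq_inv_r.
Qed.

Section LocalizationLift.
Context (C D : Category) (S : morphism_class C) (F : Functor C D)
  (FS : inverts S F).

Fixpoint formal_eval (X Y : C) (f : formal S X Y) : Hom (F X) (F Y) :=
  match f in formal _ X Y return Hom (F X) (F Y) with
  | @formal_mor _ _ X Y f => fmap F f
  | @formal_inv _ _ X Y s Ss =>
      proj1_sig (constructive_indefinite_description _ (FS Ss))
  | @formal_comp _ _ X Y Z g f => formal_eval g ∘ formal_eval f
  end.

Lemma formal_eval_eq (X Y : C) (f g : formal S X Y) :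
  formal_eq f g -> formal_eval f = formal_eval g.
Proof.
  induction 1; simpl; rewrite ?fmap_id; try congruence.
  - apply comp_id_l.
  - apply comp_id_r.
  - apply comp_assoc.
  - apply fmap_comp.
  - now destruct (constructive_indefinite_description _ (FS Ss)).
  - now destruct (constructive_indefinite_description _ (FS Ss)).
Qed.

Definition localization_lift : Functor (localization S) D.
Proof using FS.
  refine (@Build_Functor (localization S) D (fun X => F X)
            (fun X Y p => formal_eval (loc_repr p)) _ _).
  - intros X. simpl. rewrite (formal_eval_eq (loc_classK _)). apply fmap_id.
  - intros X Y Z g f. simpl. now rewrite (formal_eval_eq (loc_classK _)).
Defined.
End LocalizationLift.

Lemma functor_eq_on_maps (C D : Category) (ob : C -> D)
  (m m' : forall X Y : C, Hom X Y -> Hom (ob X) (ob Y)) i c i' c' :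
  (forall X Y (f : Hom X Y), m X Y f = m' X Y f) ->
  @Build_Functor C D ob m i c = @Build_Functor C D ob m' i' c'.
Proof.
  intros E. assert (Em : m = m').
  { do 3 (apply functional_extensionality_dep; intro). apply E. }
  subst m'. f_equal; apply proof_irrelevance.
Qed.

Theorem localization_universal (C D : Category) (S : morphism_class C)
  (F : Functor C D) :
  inverts S F -> exists! G : Functor (localization S) D, G ⊚ localization_functor S = F.
Proof.
  intros FS. exists (localization_lift FS). split.
  - destruct F as [ob m i c]. apply functor_eq_on_maps. intros X Y f.
    simpl. now rewrite (formal_eval_eq FS (loc_classK _)).
  - intros G <-. destruct G as [ob m i c]. apply functor_eq_on_maps.
    intros X Y p. simpl. rewrite <- (loc_reprK p) at 2.
    generalize (loc_repr p); clear p; intros q.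
    induction q as [U V f|U V s Ss|U V W g IHg f IHf]; simpl.
    + reflexivity.
    + match goal with |- context [constructive_indefinite_description ?P ?HP] =>
        destruct (constructive_indefinite_description P HP) as [g [E1 E2]] end.
      simpl in *.
      rewrite <- (comp_id_l (m V U _)), <- E1, <- comp_assoc, <- c.
      rewrite (loc_class_eq (feq_comp (loc_classK _) (loc_classK _))).
      rewrite (loc_class_eq (feq_inv_r Ss)), i.
      symmetry. apply comp_id_r.
    + rewrite IHg, IHf, <- c.
      apply f_equal, loc_class_eq, feq_comp; apply loc_classK.
Qed.

Definition quasi_isomorphism (X Y : Category) (H : Functor X Y) :
  morphism_class X := fun _ _ f => is_iso (fmap H f).

Definition derived_category (X Y : Category) (H : Functor X Y) : Category :=
  localization (quasi_isomorphism H).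

(** * Abelian categories *)

Record PreadditiveCategory := {
  pa_cat :> Category;
  hadd : forall X Y : pa_cat, Hom X Y -> Hom X Y -> Hom X Y;
  hopp : forall X Y : pa_cat, Hom X Y -> Hom X Y;
  hzero : forall X Y : pa_cat, Hom X Y;
  haddC : forall (X Y : pa_cat) (f g : Hom X Y), hadd f g = hadd g f;
  haddA : forall (X Y : pa_cat) (f g h : Hom X Y),
    hadd f (hadd g h) = hadd (hadd f g) h;
  hadd0 : forall (X Y : pa_cat) (f : Hom X Y), hadd (hzero X Y) f = f;
  haddN : forall (X Y : pa_cat) (f : Hom X Y), hadd (hopp f) f = hzero X Y;
  comp_hadd_l : forall (X Y Z : pa_cat) (g g' : Hom Y Z) (f : Hom X Y),
    hadd g g' ∘ f = hadd (g ∘ f) (g' ∘ f);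
  comp_hadd_r : forall (X Y Z : pa_cat) (g : Hom Y Z) (f f' : Hom X Y),
    g ∘ hadd f f' = hadd (g ∘ f) (g ∘ f') }.

Arguments hzero {_} _ _.

Definition is_zero_object (A : PreadditiveCategory) (O : A) : Prop :=
  forall X : A, (forall f : Hom X O, f = hzero X O) /\
                (forall f : Hom O X, f = hzero O X).

Definition is_biproduct (A : PreadditiveCategory) (X Y P : A)
  (i1 : Hom X P) (i2 : Hom Y P) (p1 : Hom P X) (p2 : Hom P Y) : Prop :=
  p1 ∘ i1 = idm X /\ p2 ∘ i2 = idm Y /\
  p2 ∘ i1 = hzero X Y /\ p1 ∘ i2 = hzero Y X /\
  hadd (i1 ∘ p1) (i2 ∘ p2) = idm P.

Definition is_kernel (A : PreadditiveCategory) (X Y : A) (f : Hom X Y)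
  (K : A) (k : Hom K X) : Prop :=
  f ∘ k = hzero K Y /\
  forall (W : A) (t : Hom W X), f ∘ t = hzero W Y ->
    exists! u : Hom W K, k ∘ u = t.

Definition is_cokernel (A : PreadditiveCategory) (X Y : A) (f : Hom X Y)
  (Q : A) (q : Hom Y Q) : Prop :=
  q ∘ f = hzero X Q /\
  forall (W : A) (t : Hom Y W), t ∘ f = hzero X W ->
    exists! u : Hom Q W, u ∘ q = t.

Record AbelianCategory := {
  ab_cat :> PreadditiveCategory;
  ab_zero : exists O : ab_cat, is_zero_object O;
  ab_biproduct : forall X Y : ab_cat, exists (P : ab_cat)
    (i1 : Hom X P) (i2 : Hom Y P) (p1 : Hom P X) (p2 : Hom P Y),
    is_biproduct i1 i2 p1 p2;
  ab_kernel : forall (X Y : ab_cat) (f : Hom X Y),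
    exists (K : ab_cat) (k : Hom K X), is_kernel f k;
  ab_cokernel : forall (X Y : ab_cat) (f : Hom X Y),
    exists (Q : ab_cat) (q : Hom Y Q), is_cokernel f q;
  ab_mono_normal : forall (K X : ab_cat) (k : Hom K X), is_mono k ->
    exists (Y : ab_cat) (f : Hom X Y), is_kernel f k;
  ab_epi_normal : forall (Y Q : ab_cat) (q : Hom Y Q), is_epi q ->
    exists (X : ab_cat) (f : Hom X Y), is_cokernel f q }.

Record Kernel (A : PreadditiveCategory) (X Y : A) (f : Hom X Y) := {
  ker_ob : A;
  ker_arr : Hom ker_ob X;
  ker_prop : is_kernel f ker_arr }.

(* A choice of a kernel for each morphism; [ab_kernel] only asserts existence,
   but a functor "kernel of the N-th power of d" depends on such a choice. *)
Definition kernel_choice (A : PreadditiveCategory) :=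
  forall (X Y : A) (f : Hom X Y), Kernel f.

Lemma comp_hzero_r (A : PreadditiveCategory) (X Y Z : A) (g : Hom Y Z) :
  g ∘ hzero X Y = hzero X Z.
Proof.
  rewrite <- (hadd0 (g ∘ hzero X Y)), <- (haddN (g ∘ hzero X Y)), <- haddA,
    <- comp_hadd_r.
  now rewrite hadd0, haddN.
Qed.

Lemma comp_hzero_l (A : PreadditiveCategory) (X Y Z : A) (f : Hom X Y) :
  hzero Y Z ∘ f = hzero X Z.
Proof.
  rewrite <- (hadd0 (hzero Y Z ∘ f)), <- (haddN (hzero Y Z ∘ f)), <- haddA,
    <- comp_hadd_l.
  now rewrite hadd0, haddN.
Qed.

Lemma kernel_mono (A : PreadditiveCategory) (X Y K : A) (f : Hom X Y)
  (k : Hom K X) : is_kernel f k -> is_mono k.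
Proof.
  intros [fk U] W g h E.
  destruct (U W (k ∘ g)) as [u [_ Uu]].
  { now rewrite comp_assoc, fk, comp_hzero_l. }
  now rewrite <- (Uu g), <- (Uu h).
Qed.

Definition kernel_lift (A : PreadditiveCategory) (X Y : A) (f : Hom X Y)
  (K : Kernel f) (W : A) (t : Hom W X) (ft : f ∘ t = hzero W Y) :
  Hom W (ker_ob K) :=
  proj1_sig (constructive_definite_description _ (proj2 (ker_prop K) W t ft)).

Lemma kernel_lift_comm (A : PreadditiveCategory) (X Y : A) (f : Hom X Y)
  (K : Kernel f) (W : A) (t : Hom W X) (ft : f ∘ t = hzero W Y) :
  ker_arr K ∘ kernel_lift K ft = t.
Proof.
  exact (proj2_sig (constructive_definite_description _ (proj2 (ker_prop K) W t ft))).
Qed.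

(** * Sequences and N-complexes *)

Record Sequence (A : Category) := {
  sq :> Z -> A;
  sd : forall i : Z, Hom (sq i) (sq (i + 1)%Z) }.

Record SeqHom (A : Category) (C D : Sequence A) := {
  sh :> forall i : Z, Hom (C i) (D i);
  sh_comm : forall i : Z, sh (i + 1)%Z ∘ sd C i = sd D i ∘ sh i }.

Lemma seqhom_ext (A : Category) (C D : Sequence A) (f g : SeqHom C D) :
  (forall i, f i = g i) -> f = g.
Proof.
  destruct f as [f Hf], g as [g Hg]; simpl; intros E.
  apply functional_extensionality_dep in E. subst g.
  f_equal. apply proof_irrelevance.
Qed.

Definition seqhom_id (A : Category) (C : Sequence A) : SeqHom C C.
Proof.
  refine {| sh := fun i => idm (C i) |}.
  intros i. now rewrite comp_id_l, comp_id_r.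
Defined.

Definition seqhom_comp (A : Category) (C D E : Sequence A)
  (g : SeqHom D E) (f : SeqHom C D) : SeqHom C E.
Proof.
  refine {| sh := fun i => g i ∘ f i |}.
  intros i. now rewrite <- comp_assoc, sh_comm, !comp_assoc, sh_comm.
Defined.

Definition Seq (A : Category) : Category.
Proof.
  refine {| Ob := Sequence A; Hom := @SeqHom A;
            idm := @seqhom_id A; comp := @seqhom_comp A |};
    intros; apply seqhom_ext; intros i; simpl.
  - apply comp_id_l.
  - apply comp_id_r.
  - apply comp_assoc.
Defined.

Definition translate (A : Category) (C : Sequence A) : Sequence A :=
  {| sq := fun i => C (i + 1)%Z; sd := fun i => sd C (i + 1)%Z |}.

Definition translate_map (A : Category) (C D : Sequence A) (f : SeqHom C D) :
  SeqHom (translate C) (translate D) :=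
  @Build_SeqHom A (translate C) (translate D)
    (fun i => f (i + 1)%Z) (fun i => sh_comm f (i + 1)%Z).

Definition translation (A : Category) : Functor (Seq A) (Seq A).
Proof.
  refine (@Build_Functor (Seq A) (Seq A) (@translate A) (@translate_map A) _ _);
    intros; apply seqhom_ext; reflexivity.
Defined.

Fixpoint translation_pow (A : Category) (n : nat) : Functor (Seq A) (Seq A) :=
  match n with
  | O => functor_id (Seq A)
  | S n => translation A ⊚ translation_pow A n
  end.

(* [C (i + n)] is not convertible to [translation_pow A n C i], whence the use
   of iterated translations below. *)
Lemma translation_powE (A : Category) (n : nat) (C : Seq A) (i : Z) :
  translation_pow A n C i = C (i + Z.of_nat n)%Z.
Proof.
  revert i. induction n as [|n IH]; intros i.
  - simpl. now rewrite Z.add_0_r.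
  - change (translation_pow A n C (i + 1)%Z = C (i + Z.of_nat (S n))%Z).
    rewrite IH. f_equal. lia.
Qed.

Definition dmor (A : Category) (C : Seq A) : Hom C (translation A C) :=
  @Build_SeqHom A C (translation A C) (fun i => sd C i) (fun i => eq_refl).

Fixpoint dpow (A : Category) (n : nat) (C : Seq A) : Hom C (translation_pow A n C) :=
  match n with
  | O => idm C
  | S n => dmor (translation_pow A n C) ∘ dpow n C
  end.

Definition is_Ncomplex (A : PreadditiveCategory) (N : nat) (C : Seq A) : Prop :=
  forall i : Z, dpow N C i = hzero (C i) (translation_pow A N C i).

Definition Com (A : PreadditiveCategory) (N : nat) : Category :=
  full_subcategory (@is_Ncomplex A N).

(** * The functor [ker d^N] *)

Lemma dpow_natural (A : Category) (n : nat) (C D : Seq A) (f : Hom C D) :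
  dpow n D ∘ f = fmap (translation_pow A n) f ∘ dpow n C.
Proof.
  induction n as [|n IH].
  - apply seqhom_ext; intros i. simpl. now rewrite comp_id_l, comp_id_r.
  - change (dmor (translation_pow A n D) ∘ dpow n D ∘ f
      = fmap (translation A) (fmap (translation_pow A n) f)
        ∘ (dmor (translation_pow A n C) ∘ dpow n C)).
    rewrite <- comp_assoc, IH, !comp_assoc. f_equal.
    apply seqhom_ext; intros i. symmetry.
    exact (sh_comm (fmap (translation_pow A n) f) i).
Qed.

Lemma dpow_natural_at (A : Category) (n : nat) (C D : Seq A) (f : Hom C D) i :
  dpow n D i ∘ f i = fmap (translation_pow A n) f i ∘ dpow n C i.
Proof.
  exact (f_equal (fun h : SeqHom C (translation_pow A n D) => h i)
           (dpow_natural n f)).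
Qed.

Lemma translation_pow_mono (A : Category) (n : nat) (C D : Seq A) (f : Hom C D) :
  (forall i, is_mono (f i)) -> forall i, is_mono (fmap (translation_pow A n) f i).
Proof.
  intros Hf. induction n as [|n IH]; intros i; [apply Hf|exact (IH (i + 1)%Z)].
Qed.

Section KernelFunctor.
Context (A : PreadditiveCategory) (k : kernel_choice A) (N : nat).

Let K (C : Seq A) (i : Z) : Kernel (dpow N C i) := k (dpow N C i).

Lemma kerdN_d_vanish (C : Seq A) (i : Z) :
  dpow N C (i + 1)%Z ∘ (sd C i ∘ ker_arr (K C i)) = hzero _ _.
Proof.
  rewrite comp_assoc, (sh_comm (dpow N C)), <- comp_assoc.
  now rewrite (proj1 (ker_prop (K C i))), comp_hzero_r.
Qed.

Definition kerdN_seq (C : Seq A) : Seq A :=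
  {| sq := fun i => ker_ob (K C i);
     sd := fun i => kernel_lift (K C (i + 1)%Z) (kerdN_d_vanish C i) |}.

Definition kerdN_incl (C : Seq A) : Hom (kerdN_seq C) C.
Proof.
  refine (@Build_SeqHom A (kerdN_seq C) C (fun i => ker_arr (K C i)) _).
  intros i. apply kernel_lift_comm.
Defined.

Lemma kerdN_incl_mono (C : Seq A) (i : Z) : is_mono (kerdN_incl C i).
Proof. exact (kernel_mono (ker_prop (K C i))). Qed.

Lemma kerdN_is_Ncomplex (C : Seq A) : is_Ncomplex N (kerdN_seq C).
Proof.
  intros i.
  apply (translation_pow_mono (n := N) (kerdN_incl_mono (C := C)) (i := i)).
  rewrite <- dpow_natural_at, comp_hzero_r.
  exact (proj1 (ker_prop (K C i))).
Qed.

Lemma kerdN_map_vanish (C D : Seq A) (f : Hom C D) (i : Z) :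
  dpow N D i ∘ (f i ∘ ker_arr (K C i)) = hzero _ _.
Proof.
  rewrite comp_assoc, dpow_natural_at, <- comp_assoc.
  now rewrite (proj1 (ker_prop (K C i))), comp_hzero_r.
Qed.

Definition kerdN_map (C D : Seq A) (f : Hom C D) :
  Hom (kerdN_seq C) (kerdN_seq D).
Proof.
  refine (@Build_SeqHom A (kerdN_seq C) (kerdN_seq D)
            (fun i => kernel_lift (K D i) (kerdN_map_vanish f i)) _).
  intros i. apply (kerdN_incl_mono (C := D)). simpl.
  rewrite !comp_assoc, !kernel_lift_comm, <- !comp_assoc, !kernel_lift_comm.
  now rewrite !comp_assoc, sh_comm.
Defined.

Lemma kerdN_map_comm (C D : Seq A) (f : Hom C D) :
  kerdN_incl D ∘ kerdN_map f = f ∘ kerdN_incl C.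
Proof. apply seqhom_ext; intros i. apply kernel_lift_comm. Qed.

Definition kerdN : Functor (Seq A) (Com A N).
Proof.
  refine (@Build_Functor (Seq A) (Com A N)
            (fun C => exist _ (kerdN_seq C) (kerdN_is_Ncomplex C))
            (fun C D f => kerdN_map f) _ _).
  - intros C. apply seqhom_ext; intros i. apply (kerdN_incl_mono (C := C)).
    simpl. now rewrite kernel_lift_comm, comp_id_l, comp_id_r.
  - intros C D E g f. apply seqhom_ext; intros i. apply (kerdN_incl_mono (C := E)).
    simpl. rewrite comp_assoc, !kernel_lift_comm, <- !comp_assoc.
    now rewrite kernel_lift_comm.
Defined.

(* On N-complexes the functor is the identity, up to the choice of kernels of
   zero morphisms. *)
Lemma kerdN_on_Com :
  naturally_isomorphic (kerdN ⊚ subcategory_inclusion (@is_Ncomplex A N))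
    (functor_id (Com A N)).
Proof.
  exists (fun C => kerdN_incl (proj1_sig C)). split.
  - intros C D f. exact (kerdN_map_comm f).
  - intros [C HC]. simpl.
    assert (V : forall i, dpow N C i ∘ idm (C i) = hzero _ _).
    { intros i. rewrite comp_id_r. apply HC. }
    unshelve eexists.
    + refine (@Build_SeqHom A C (kerdN_seq C)
                (fun i => kernel_lift (K C i) (V i)) _).
      intros i. apply (kerdN_incl_mono (C := C)). simpl.
      rewrite !comp_assoc, !kernel_lift_comm, <- !comp_assoc, kernel_lift_comm.
      now rewrite comp_id_l, comp_id_r.
    + split; apply seqhom_ext; intros i.
      * apply (kerdN_incl_mono (C := C)). simpl.
        rewrite comp_assoc, kernel_lift_comm. now rewrite comp_id_l, comp_id_r.
      * apply kernel_lift_comm.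
Qed.
End KernelFunctor.

(* Main.v *)
(* The kernel functor [ker d^N] and the inclusion of N-complexes both preserve
   H-quasi-isomorphisms, so they descend to functors between the localizations.
   The inclusion [ker d^N C -> C] is natural, and [ker d^N] sends it to an
   isomorphism because the kernel of the zero map on [ker d^N C] is everything;
   hence it is an H-quasi-isomorphism for every [E], and it becomes invertible in
   both localizations, making the two induced functors mutually quasi-inverse. *)

Require Import Defs.

Set Implicit Arguments.
Unset Strict Implicit.

Lemma is_iso_comp (C : Category) (X Y Z : C) (g : Hom Y Z) (f : Hom X Y) :
  is_iso g -> is_iso f -> is_iso (g ∘ f).
Proof.
  intros [g' [Eg Eg']] [f' [Ef Ef']]. exists (f' ∘ g'). split.
  - now rewrite comp_assoc, <- (comp_assoc f'), Eg, comp_id_r.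
  - now rewrite comp_assoc, <- (comp_assoc g), Ef', comp_id_r.
Qed.

Lemma is_iso_cancel_l (C : Category) (X Y Z : C) (g : Hom Y Z) (f : Hom X Y) :
  is_iso g -> is_iso (g ∘ f) -> is_iso f.
Proof.
  intros [g' [Eg Eg']] Hgf.
  rewrite <- (comp_id_l f), <- Eg, <- comp_assoc.
  apply is_iso_comp; [now exists g|exact Hgf].
Qed.

Lemma is_iso_fmap (C D : Category) (F : Functor C D) (X Y : C) (f : Hom X Y) :
  is_iso f -> is_iso (fmap F f).
Proof.
  intros [g [E E']]. exists (fmap F g).
  now rewrite <- !fmap_comp, E, E', !fmap_id.
Qed.

(** Every morphism of the localization is a composite of images of morphisms of [C] and formal
    inverses, and a naturality square for [s] yields one for its inverse. Naturality thus need only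
    be tested on [C]. *)
Lemma localization_natural (C D : Category) (S : morphism_class C)
  (F G : Functor (localization S) D) (eta : forall X : C, Hom (F X) (G X)) :
  (forall (X Y : C) (f : Hom X Y),
     eta Y ∘ fmap F (fmap (localization_functor S) f)
     = fmap G (fmap (localization_functor S) f) ∘ eta X) ->
  forall (X Y : localization S) (p : Hom X Y),
    eta Y ∘ fmap F p = fmap G p ∘ eta X.
Proof.
  intros Hmor X Y p. rewrite <- (loc_reprK p).
  generalize (loc_repr p); clear p; intros q.
  induction q as [U V f|U V s Ss|U V W g IHg f IHf].
  - apply Hmor.
  - set (s' := loc_class (formal_inv Ss) : @Hom (localization S) V U).
    set (t := loc_class (formal_mor S s) : @Hom (localization S) U V).
    assert (E1 : s' ∘ t = @idm (localization S) U).
    { eapply eq_trans; [symmetry; apply localization_comp_class|].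
      apply loc_class_eq, feq_inv_l. }
    assert (E2 : t ∘ s' = @idm (localization S) V).
    { eapply eq_trans; [symmetry; apply localization_comp_class|].
      apply loc_class_eq, feq_inv_r. }
    assert (Ht : eta V ∘ fmap F t = fmap G t ∘ eta U) by exact (Hmor U V s).
    (* Insert [fmap G s' ∘ fmap G t] on the left, move [eta] across [t] by [Ht], then cancel
       [fmap F t] against [fmap F s']. *)
    rewrite <- (comp_id_l (eta U ∘ _)), <- fmap_id, <- E1, fmap_comp.
    rewrite comp_assoc, <- (comp_assoc (fmap G s')), <- Ht.
    rewrite <- !comp_assoc, <- fmap_comp.
    now rewrite E2, fmap_id, comp_id_r.
  - rewrite localization_comp_class, !fmap_comp.
    now rewrite comp_assoc, IHg, <- comp_assoc, IHf, comp_assoc.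
Qed.

Definition preserves_class (C D : Category) (S : morphism_class C)
  (S' : morphism_class D) (F : Functor C D) :=
  forall (X Y : C) (s : Hom X Y), S X Y s -> S' (F X) (F Y) (fmap F s).

Lemma preserves_class_inverts (C D : Category) (S : morphism_class C)
  (S' : morphism_class D) (F : Functor C D) :
  preserves_class S S' F -> inverts S (localization_functor S' ⊚ F).
Proof.
  intros FS X Y s Ss. exact (localization_functor_inverts (FS X Y s Ss)).
Qed.

Definition localization_map (C D : Category) (S : morphism_class C)
  (S' : morphism_class D) (F : Functor C D) (FS : preserves_class S S' F) :
  Functor (localization S) (localization S') :=
  localization_lift (preserves_class_inverts FS).

(** Evaluation respects [formal_eq], so the representative chosen for the class of [f] does not
    matter. *)
Lemma localization_mapE (C D : Category) (S : morphism_class C)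
  (S' : morphism_class D) (F : Functor C D) (FS : preserves_class S S' F)
  (X Y : C) (f : Hom X Y) :
  fmap (localization_map FS) (fmap (localization_functor S) f)
  = fmap (localization_functor S') (fmap F f).
Proof.
  exact (formal_eval_eq (preserves_class_inverts FS) (loc_classK _)).
Qed.

(** The components of [eta] lie in [S], so they become invertible after localizing. It serves for
    both composites of the equivalence, with the roles of the two functors exchanged. *)
Lemma localization_map_retract (C D : Category) (S : morphism_class C)
  (S' : morphism_class D) (F : Functor C D) (G : Functor D C)
  (FS : preserves_class S S' F) (GS : preserves_class S' S G)
  (eta : forall X : C, Hom (G (F X)) X) :
  (forall (X Y : C) (f : Hom X Y), eta Y ∘ fmap G (fmap F f) = f ∘ eta X) ->
  (forall X : C, S _ _ (eta X)) ->
  naturally_isomorphic (localization_map GS ⊚ localization_map FS)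
    (functor_id (localization S)).
Proof.
  intros Hnat HS.
  exists (fun X => fmap (localization_functor S) (eta X)). split.
  - apply (@localization_natural C (localization S) S
      (localization_map GS ⊚ localization_map FS) (functor_id (localization S))
      (fun X => fmap (localization_functor S) (eta X))).
    intros X Y f.
    change (fmap (localization_functor S) (eta Y)
      ∘ fmap (localization_map GS)
          (fmap (localization_map FS) (fmap (localization_functor S) f))
      = fmap (localization_functor S) f ∘ fmap (localization_functor S) (eta X)).
    rewrite (localization_mapE FS f).
    rewrite <- fmap_comp, <- Hnat, fmap_comp.
    exact (f_equal _ (localization_mapE GS (fmap F f))).
  - intros X. apply (localization_functor_inverts (HS X)).
Qed.

(** As [d^N] vanishes, the identity of each [C i] lifts through the kernel; these lifts form the
    inverse. *)
Lemma kerdN_incl_iso (A : PreadditiveCategory) (k : kernel_choice A) (N : nat)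
  (C : Seq A) : is_Ncomplex N C -> is_iso (kerdN_incl k N C).
Proof.
  intros HC.
  assert (V : forall i, dpow N C i ∘ idm (C i) = hzero _ _).
  { intros i. rewrite comp_id_r. apply HC. }
  unshelve eexists.
  - refine (@Build_SeqHom A C (kerdN_seq k N C)
              (fun i => kernel_lift (k _ _ (dpow N C i)) (V i)) _).
    intros i. apply (@kerdN_incl_mono A k N C _). simpl.
    rewrite !comp_assoc, !kernel_lift_comm, <- !comp_assoc, kernel_lift_comm.
    now rewrite comp_id_l, comp_id_r.
  - split; apply seqhom_ext; intros i.
    + apply (@kerdN_incl_mono A k N C i). simpl.
      rewrite comp_assoc, kernel_lift_comm. now rewrite comp_id_l, comp_id_r.
    + apply kernel_lift_comm.
Qed.

(** Naturality of the inclusion at the inclusion itself makes both sides agree after composing with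
    the monomorphism [kerdN_incl k N C]. *)
Lemma kerdN_map_incl (A : PreadditiveCategory) (k : kernel_choice A) (N : nat)
  (C : Seq A) :
  kerdN_map k N (kerdN_incl k N C) = kerdN_incl k N (kerdN_seq k N C).
Proof.
  apply seqhom_ext; intros i. apply (@kerdN_incl_mono A k N C i).
  exact (f_equal (fun h : SeqHom _ _ => h i)
           (kerdN_map_comm k N (kerdN_incl k N C))).
Qed.

Theorem theorem7 :
  forall (A : AbelianCategory) (k : kernel_choice A)
         (N : nat) (hN : 1 <= N)
         (B : Seq A -> Prop) (hB : forall X : Seq A, is_Ncomplex N X -> B X)
         (C : Category) (E : Functor (Com A N) C),
  let H : Functor (full_subcategory B) C :=
    E ⊚ (kerdN k N ⊚ subcategory_inclusion B) in
  equivalent_categories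
    (derived_category H)
    (derived_category (H ⊚ subcategory_widen hB)).
Proof.
  intros A k N hN B hB C E H.
  set (K := kerdN k N ⊚ subcategory_inclusion B).
  set (J := subcategory_widen hB).
  set (S := quasi_isomorphism H).
  set (S' := quasi_isomorphism (H ⊚ J)).
  (* [eps] and [delta] are the same inclusion, read in the category given by [B] and in [Com A N];
     only [delta] is invertible before localizing. *)
  pose (eps := fun X : full_subcategory B =>
    kerdN_incl k N (proj1_sig X) : Hom (J (K X)) X).
  pose (delta := fun Y : Com A N =>
    kerdN_incl k N (proj1_sig Y) : Hom (K (J Y)) Y).
  assert (delta_nat : forall (X Y : Com A N) (f : Hom X Y),
    delta Y ∘ fmap K (fmap J f) = f ∘ delta X).
  { intros X Y f. exact (kerdN_map_comm k N f). }
  assert (delta_iso : forall Y, is_iso (delta Y)).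
  { intros [Y HY]. exact (kerdN_incl_iso k HY). }
  assert (K_eps : forall X, fmap K (eps X) = delta (K X)).
  { intros X. exact (kerdN_map_incl k N (proj1_sig X)). }
  (* Membership in [S] concerns [K s], membership of [K s] in [S'] concerns [K (J (K s))]; the
     isomorphisms [delta] conjugate one into the other. *)
  assert (KS : preserves_class S S' K).
  { intros X Y s Ss.
    change (is_iso (fmap E (fmap K (fmap J (fmap K s))))).
    apply is_iso_cancel_l with (g := fmap E (delta (K Y))).
    - apply is_iso_fmap, delta_iso.
    - rewrite <- fmap_comp, delta_nat, fmap_comp.
      apply is_iso_comp; [exact Ss|apply is_iso_fmap, delta_iso]. }
  (* By definition [S'] is the preimage of [S] under [J]. *)
  assert (JS : preserves_class S' S J).
  { intros X Y s Ss. exact Ss. }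
  exists (localization_map KS), (localization_map JS). split.
  - apply localization_map_retract with (eta := eps).
    + intros X Y f. exact (kerdN_map_comm k N f).
    + intros X. change (is_iso (fmap E (fmap K (eps X)))).
      (* [K X] is an N-complex, so [delta (K X)] is invertible and any [E] keeps it so. *)
      rewrite K_eps. apply is_iso_fmap, delta_iso.
  - apply localization_map_retract with (eta := delta).
    + exact delta_nat.
    + intros Y. apply is_iso_fmap, delta_iso.
Qed.
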